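(* Let $F\colon\mathcal C\to\mathcal D$ be a tensor functor between finite tensor categories. If $F$ is perfect, then the lax monoidal functor $F^{\mathrm{ra}}\colon\mathcal D\to\mathcal C$ preserves exactness of algebras: if $A$ is an exact algebra in $\mathcal D$, then $F^{\mathrm{ra}}(A)$ is an exact algebra in $\mathcal C$.
   Context: Work over an algebraically closed field $\Bbbk$. A finite tensor category is a finite $\Bbbk$-linear abelian rigid monoidal category with bilinear tensor product and $\mathrm{End}(\mathbb 1)\cong\Bbbk$; a tensor functor is an exact $\Bbbk$-linear strong monoidal functor. $F^{\mathrm{ra}}$ is the right adjoint of $F$ with lax monoidal structure induced from $F$. $F$ is perfect if $F^{\mathrm{ra}}$ is exact (equivalently, $F$ preserves projective objects). A left $\mathcal C$-module category $\mathcal M$ is exact if $p\triangleright m$ is projective for every projective $p\in\mathcal C$ and every $m\in\mathcal M$. An algebra $A$ in $\mathcal C$ is exact if the left $\mathcal C$-module category of right $A$-modules in $\mathcal C$ is exact. *)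

(* Defs.v *)
From HB Require Import structures.
From mathcomp Require Import all_boot all_algebra.

Set Implicit Arguments.
Unset Strict Implicit.
Unset Printing Implicit Defensive.

Import GRing.Theory.
Local Open Scope ring_scope.

Declare Scope cat_scope.
Delimit Scope cat_scope with cat.
Local Open Scope cat_scope.

Reserved Notation "g ∘ f" (at level 40, left associativity).
Reserved Notation "X ⊗ Y" (at level 38, left associativity).
Reserved Notation "f ⊗ₘ g" (at level 38, left associativity).
Reserved Notation "X ▷ M" (at level 37, right associativity).
Reserved Notation "f ▷ₘ g" (at level 37, right associativity).

Lemma linear_at0 (k : fieldType) (U V : lmodType k) (f : U -> V) :
  linear f -> f 0 = 0.
Proof.
by move=> /(_ (-1) 0 0); rewrite scaler0 addr0 scaleN1r addNr.
Qed.

Record linCat (k : fieldType) := LinCat {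
  obj :> Type;
  hom : obj -> obj -> lmodType k;
  idm : forall X, hom X X;
  comp : forall X Y Z, hom Y Z -> hom X Y -> hom X Z;
  comp1m : forall X Y (f : hom X Y), comp (idm Y) f = f;
  compm1 : forall X Y (f : hom X Y), comp f (idm X) = f;
  compA : forall W X Y Z (h : hom Y Z) (g : hom X Y) (f : hom W X),
    comp h (comp g f) = comp (comp h g) f;
  comp_linearl : forall X Y Z (f : hom X Y),
    linear (fun g : hom Y Z => comp g f);
  comp_linearr : forall X Y Z (g : hom Y Z),
    linear (fun f : hom X Y => comp g f)
}.
Arguments hom {k C} : rename.
Arguments idm {k C} : rename.
Arguments comp {k C X Y Z} : rename.
Notation "g ∘ f" := (comp g f) : cat_scope.

Section CategoryNotions.
Variables (k : fieldType) (C : linCat k).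
Implicit Types X Y Z P S K Q : C.

Definition is_iso X Y (f : hom X Y) : Prop :=
  exists g : hom Y X, g ∘ f = idm X /\ f ∘ g = idm Y.

Definition isomorphic X Y : Prop := exists f : hom X Y, is_iso f.

Definition mono X Y (f : hom X Y) : Prop :=
  forall W (g h : hom W X), f ∘ g = f ∘ h -> g = h.

Definition epi X Y (f : hom X Y) : Prop :=
  forall Z (g h : hom Y Z), g ∘ f = h ∘ f -> g = h.

Definition projective P : Prop :=
  forall X Y (e : hom X Y) (f : hom P Y), epi e ->
    exists g : hom P X, e ∘ g = f.

Definition is_zero Z : Prop :=
  forall X, (forall f : hom X Z, f = 0) /\ (forall f : hom Z X, f = 0).

Definition is_biproduct X Y P (i1 : hom X P) (i2 : hom Y P)
    (p1 : hom P X) (p2 : hom P Y) : Prop :=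
  [/\ p1 ∘ i1 = idm X, p2 ∘ i2 = idm Y, p1 ∘ i2 = 0, p2 ∘ i1 = 0
    & i1 ∘ p1 + i2 ∘ p2 = idm P].

Definition is_kernel K X Y (i : hom K X) (f : hom X Y) : Prop :=
  f ∘ i = 0 /\
  forall W (h : hom W X), f ∘ h = 0 -> exists! u : hom W K, i ∘ u = h.

Definition is_cokernel X Y Q (q : hom Y Q) (f : hom X Y) : Prop :=
  q ∘ f = 0 /\
  forall Z (h : hom Y Z), h ∘ f = 0 -> exists! u : hom Q Z, u ∘ q = h.

(* 0 -> X -> Y -> Z -> 0 is exact. *)
Definition short_exact X Y Z (f : hom X Y) (g : hom Y Z) : Prop :=
  is_kernel f g /\ is_cokernel g f.

Definition simple S : Prop :=
  ~ is_zero S /\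
  forall X (i : hom X S), mono i -> is_zero X \/ is_iso i.

(* Y is built from X by one step of a filtration 0 = X_0 ⊂ ... ⊂ X_n with
   simple quotients X_i / X_(i-1). *)
Inductive finite_length : C -> Prop :=
| finite_length_zero X : is_zero X -> finite_length X
| finite_length_ext X Y S (f : hom X Y) (g : hom Y S) :
    short_exact f g -> simple S -> finite_length X -> finite_length Y.

End CategoryNotions.

Record is_abelian (k : fieldType) (C : linCat k) : Prop := IsAbelian {
  abelian_zero : exists Z : C, is_zero Z;
  abelian_biproduct : forall X Y : C,
    exists (P : C) (i1 : hom X P) (i2 : hom Y P) (p1 : hom P X) (p2 : hom P Y),
      is_biproduct i1 i2 p1 p2;
  abelian_kernel : forall (X Y : C) (f : hom X Y),
    exists (K : C) (i : hom K X), is_kernel i f;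
  abelian_cokernel : forall (X Y : C) (f : hom X Y),
    exists (Q : C) (q : hom Y Q), is_cokernel q f;
  abelian_mono : forall (X Y : C) (f : hom X Y), mono f ->
    exists (Z : C) (g : hom Y Z), is_kernel f g;
  abelian_epi : forall (X Y : C) (f : hom X Y), epi f ->
    exists (W : C) (g : hom W X), is_cokernel f g
}.

Record is_finite_cat (k : fieldType) (C : linCat k) : Prop := IsFiniteCat {
  finite_hom : forall X Y : C,
    exists (n : nat) (f : hom X Y -> 'rV[k]_n), linear f /\ bijective f;
  finite_objects : forall X : C, finite_length X;
  finite_enough_projectives : forall X : C,
    exists (P : C) (e : hom P X), projective P /\ epi e;
  finite_simples : exists (n : nat) (S : 'I_n -> C),
    forall X : C, simple X -> exists i, isomorphic X (S i)
}.

Record functor (k : fieldType) (C D : linCat k) := Functor {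
  fobj :> C -> D;
  fmap : forall X Y : C, hom X Y -> hom (fobj X) (fobj Y);
  fmap1 : forall X, fmap (idm X) = idm (fobj X);
  fmapM : forall X Y Z (g : hom Y Z) (f : hom X Y),
    fmap (g ∘ f) = fmap g ∘ fmap f
}.
Arguments fmap {k C D} F {X Y} : rename.

Definition linear_functor (k : fieldType) (C D : linCat k) (F : functor C D) :=
  forall X Y : C, linear (fmap F : hom X Y -> hom (F X) (F Y)).

Definition exact_functor (k : fieldType) (C D : linCat k) (F : functor C D) :=
  forall (X Y Z : C) (f : hom X Y) (g : hom Y Z),
    short_exact f g -> short_exact (fmap F f) (fmap F g).

(* Linearity of the right adjoint of a linear functor is automatic. *)
Record right_adjoint (k : fieldType) (C D : linCat k) (F : functor C D) :=
  RightAdjoint {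
  radj :> functor D C;
  unit_adj : forall X : C, hom X (radj (F X));
  counit_adj : forall Y : D, hom (F (radj Y)) Y;
  unit_adj_nat : forall (X X' : C) (f : hom X X'),
    unit_adj X' ∘ f = fmap radj (fmap F f) ∘ unit_adj X;
  counit_adj_nat : forall (Y Y' : D) (g : hom Y Y'),
    g ∘ counit_adj Y = counit_adj Y' ∘ fmap F (fmap radj g);
  adj_triangle_l : forall X : C,
    counit_adj (F X) ∘ fmap F (unit_adj X) = idm (F X);
  adj_triangle_r : forall Y : D,
    fmap radj (counit_adj Y) ∘ unit_adj (radj Y) = idm (radj Y)
}.

Record monCat (k : fieldType) := MonCat {
  mcat :> linCat k;
  one : mcat;
  tens : mcat -> mcat -> mcat;
  tensm : forall X X' Y Y' : mcat,
    hom X X' -> hom Y Y' -> hom (tens X Y) (tens X' Y');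
  tensm1 : forall X Y, tensm (idm X) (idm Y) = idm (tens X Y);
  tensmM : forall (X X' X'' Y Y' Y'' : mcat) (f' : hom X' X'') (f : hom X X')
      (g' : hom Y' Y'') (g : hom Y Y'),
    tensm (f' ∘ f) (g' ∘ g) = tensm f' g' ∘ tensm f g;
  tensm_linearl : forall (X X' Y Y' : mcat) (g : hom Y Y'),
    linear (fun f : hom X X' => tensm f g);
  tensm_linearr : forall (X X' Y Y' : mcat) (f : hom X X'),
    linear (fun g : hom Y Y' => tensm f g);
  assoc : forall X Y Z, hom (tens (tens X Y) Z) (tens X (tens Y Z));
  associ : forall X Y Z, hom (tens X (tens Y Z)) (tens (tens X Y) Z);
  assocK : forall X Y Z, associ X Y Z ∘ assoc X Y Z = idm _;
  associK : forall X Y Z, assoc X Y Z ∘ associ X Y Z = idm _;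
  assoc_nat : forall X X' Y Y' Z Z'
      (f : hom X X') (g : hom Y Y') (h : hom Z Z'),
    assoc X' Y' Z' ∘ tensm (tensm f g) h
    = tensm f (tensm g h) ∘ assoc X Y Z;
  lunit : forall X, hom (tens one X) X;
  luniti : forall X, hom X (tens one X);
  lunitK : forall X, luniti X ∘ lunit X = idm _;
  lunitiK : forall X, lunit X ∘ luniti X = idm _;
  lunit_nat : forall X X' (f : hom X X'),
    lunit X' ∘ tensm (idm one) f = f ∘ lunit X;
  runit : forall X, hom (tens X one) X;
  runiti : forall X, hom X (tens X one);
  runitK : forall X, runiti X ∘ runit X = idm _;
  runitiK : forall X, runit X ∘ runiti X = idm _;
  runit_nat : forall X X' (f : hom X X'),
    runit X' ∘ tensm f (idm one) = f ∘ runit X;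
  pentagon : forall W X Y Z,
    assoc W X (tens Y Z) ∘ assoc (tens W X) Y Z
    = tensm (idm W) (assoc X Y Z) ∘ assoc W (tens X Y) Z
      ∘ tensm (assoc W X Y) (idm Z);
  triangle : forall X Y,
    tensm (idm X) (lunit Y) ∘ assoc X one Y = tensm (runit X) (idm Y)
}.
Arguments one {k} C : rename.
Arguments tens {k C} : rename.
Arguments tensm {k C X X' Y Y'} : rename.
Arguments assoc {k C} : rename.
Arguments associ {k C} : rename.
Arguments lunit {k C} : rename.
Arguments luniti {k C} : rename.
Arguments runit {k C} : rename.
Arguments runiti {k C} : rename.
Notation "X ⊗ Y" := (tens X Y) : cat_scope.
Notation "f ⊗ₘ g" := (tensm f g) : cat_scope.

Definition is_left_dual (k : fieldType) (C : monCat k) (X X' : C)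
    (ev : hom (X' ⊗ X) (one C)) (coev : hom (one C) (X ⊗ X')) : Prop :=
  runit X ∘ (idm X ⊗ₘ ev) ∘ assoc X X' X ∘ (coev ⊗ₘ idm X) ∘ luniti X
    = idm X
  /\
  lunit X' ∘ (ev ⊗ₘ idm X') ∘ associ X' X X' ∘ (idm X' ⊗ₘ coev) ∘ runiti X'
    = idm X'.

(* X' is a right dual of X iff X is a left dual of X'. *)
Definition is_rigid (k : fieldType) (C : monCat k) : Prop := forall X : C,
  (exists (X' : C) ev coev, @is_left_dual k C X X' ev coev) /\
  (exists (X' : C) ev coev, @is_left_dual k C X' X ev coev).

Record finTensorCat (k : fieldType) := FinTensorCat {
  ftc :> monCat k;
  ftc_abelian : is_abelian ftc;
  ftc_finite : is_finite_cat ftc;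
  ftc_rigid : is_rigid ftc;
  ftc_end_one : bijective (fun c : k => c *: idm (one ftc))
}.

Section Kelly.
Variables (k : fieldType) (C : monCat k).
Implicit Types X Y Z : C.

Lemma tens1mM X Y Y' Y'' (g' : hom Y' Y'') (g : hom Y Y') :
  (idm X ⊗ₘ (g' ∘ g)) = (idm X ⊗ₘ g') ∘ (idm X ⊗ₘ g).
Proof. by rewrite -tensmM comp1m. Qed.

Lemma tensm1M X Y Y' Y'' (g' : hom Y' Y'') (g : hom Y Y') :
  ((g' ∘ g) ⊗ₘ idm X) = (g' ⊗ₘ idm X) ∘ (g ⊗ₘ idm X).
Proof. by rewrite -tensmM comp1m. Qed.

Lemma tensm_swap X X' Y Y' (f : hom X X') (g : hom Y Y') :
  (f ⊗ₘ idm Y') ∘ (idm X ⊗ₘ g) = (idm X' ⊗ₘ g) ∘ (f ⊗ₘ idm Y).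
Proof. by rewrite -!tensmM !comp1m !compm1. Qed.

Lemma tens1_inj X Y (f g : hom X Y) :
  f ⊗ₘ idm (one C) = g ⊗ₘ idm (one C) -> f = g.
Proof.
move=> fg; have := congr1 (fun h => runit Y ∘ h ∘ runiti X) fg.
by rewrite !runit_nat -!compA !runitiK !compm1.
Qed.

Lemma one_tens_inj X Y (f g : hom X Y) :
  idm (one C) ⊗ₘ f = idm (one C) ⊗ₘ g -> f = g.
Proof.
move=> fg; have := congr1 (fun h => lunit Y ∘ h ∘ luniti X) fg.
by rewrite !lunit_nat -!compA !lunitiK !compm1.
Qed.

Lemma assoc_mono X Y Z W (f g : hom W (X ⊗ Y ⊗ Z)) :
  assoc X Y Z ∘ f = assoc X Y Z ∘ g -> f = g.
Proof.
by move=> /(congr1 (comp (associ X Y Z))); rewrite !compA !assocK !comp1m.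
Qed.

Lemma assoc_epi X Y Z W (f g : hom (X ⊗ (Y ⊗ Z)) W) :
  f ∘ assoc X Y Z = g ∘ assoc X Y Z -> f = g.
Proof.
move=> /(congr1 (fun h => h ∘ associ X Y Z)).
by rewrite -!compA !associK !compm1.
Qed.

Lemma runit_tens X Y :
  (idm X ⊗ₘ runit Y) ∘ assoc X Y (one C) = runit (X ⊗ Y).
Proof.
apply: tens1_inj; apply: assoc_mono.
rewrite -(triangle (X ⊗ Y)) -(tensm1 X Y) [RHS]compA assoc_nat -[RHS]compA.
by rewrite pentagon tensm1M !compA assoc_nat -tens1mM triangle.
Qed.

Lemma lunit_tens X Y :
  lunit (X ⊗ Y) ∘ assoc (one C) X Y = lunit X ⊗ₘ idm Y.
Proof.
apply: one_tens_inj; apply: assoc_epi.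
have iso_epi W (f g : hom (one C ⊗ (one C ⊗ X) ⊗ Y) W) :
    f ∘ (assoc (one C) (one C) X ⊗ₘ idm Y)
    = g ∘ (assoc (one C) (one C) X ⊗ₘ idm Y) -> f = g.
  move=> /(congr1 (fun h => h ∘ (associ (one C) (one C) X ⊗ₘ idm Y))).
  by rewrite -!compA -!tensm1M associK !tensm1 !compm1.
apply: iso_epi.
rewrite -(assoc_nat (idm _) (lunit X) (idm Y)) -[RHS]compA -tensm1M triangle.
rewrite assoc_nat tensm1 -triangle tens1mM -!compA; congr (_ ∘ _).
by rewrite pentagon compA.
Qed.

End Kelly.

Record laxFunctor (k : fieldType) (C D : monCat k) := LaxFunctor {
  lax_functor :> functor C D;
  lax_mul : forall X Y : C,
    hom (lax_functor X ⊗ lax_functor Y) (lax_functor (X ⊗ Y));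
  lax_one : hom (one D) (lax_functor (one C));
  lax_mul_nat : forall (X X' Y Y' : C) (f : hom X X') (g : hom Y Y'),
    lax_mul X' Y' ∘ (fmap lax_functor f ⊗ₘ fmap lax_functor g)
    = fmap lax_functor (f ⊗ₘ g) ∘ lax_mul X Y;
  lax_mulA : forall X Y Z : C,
    fmap lax_functor (assoc X Y Z) ∘ lax_mul (X ⊗ Y) Z
      ∘ (lax_mul X Y ⊗ₘ idm (lax_functor Z))
    = lax_mul X (Y ⊗ Z) ∘ (idm (lax_functor X) ⊗ₘ lax_mul Y Z)
      ∘ assoc (lax_functor X) (lax_functor Y) (lax_functor Z);
  lax_mul1l : forall X : C,
    fmap lax_functor (lunit X) ∘ lax_mul (one C) X
      ∘ (lax_one ⊗ₘ idm (lax_functor X)) = lunit (lax_functor X);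
  lax_mul1r : forall X : C,
    fmap lax_functor (runit X) ∘ lax_mul X (one C)
      ∘ (idm (lax_functor X) ⊗ₘ lax_one) = runit (lax_functor X)
}.
Arguments lax_mul {k C D} F : rename.
Arguments lax_one {k C D} F : rename.

(* A strong structure is a lax one whose structure maps are invertible. *)
Record tensorFunctor (k : fieldType) (C D : monCat k) := TensorFunctor {
  tf_lax :> laxFunctor C D;
  tf_muli : forall X Y : C, hom (tf_lax (X ⊗ Y)) (tf_lax X ⊗ tf_lax Y);
  tf_mulK : forall X Y, tf_muli X Y ∘ lax_mul tf_lax X Y = idm _;
  tf_muliK : forall X Y, lax_mul tf_lax X Y ∘ tf_muli X Y = idm _;
  tf_onei : hom (tf_lax (one C)) (one D);
  tf_oneK : tf_onei ∘ lax_one tf_lax = idm _;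
  tf_oneiK : lax_one tf_lax ∘ tf_onei = idm _;
  tf_linear : linear_functor tf_lax;
  tf_exact : exact_functor tf_lax
}.
Arguments tf_muli {k C D} F : rename.
Arguments tf_onei {k C D} F : rename.

Definition perfect (k : fieldType) (C D : finTensorCat k)
    (F : tensorFunctor C D) (Fra : right_adjoint F) : Prop :=
  exact_functor Fra.
Arguments perfect {k C D} F Fra.

Section AdjointLax.
Variables (k : fieldType) (C D : monCat k) (F : tensorFunctor C D).
Variable R : right_adjoint F.

Let G : functor D C := R.
Let eta := unit_adj R.
Let eps := counit_adj R.

Definition radj_mul (X Y : D) : hom (G X ⊗ G Y) (G (X ⊗ Y)) :=
  fmap G ((eps X ⊗ₘ eps Y) ∘ tf_muli F (G X) (G Y)) ∘ eta (G X ⊗ G Y).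

Definition radj_one : hom (one C) (G (one D)) :=
  fmap G (tf_onei F) ∘ eta (one C).

Lemma radj_inj (X : C) (Y : D) (f g : hom X (G Y)) :
  eps Y ∘ fmap F f = eps Y ∘ fmap F g -> f = g.
Proof.
move=> /(congr1 (fun h => fmap G h ∘ eta X)).
rewrite !fmapM -!compA -!unit_adj_nat !compA.
by rewrite !adj_triangle_r !comp1m.
Qed.

Lemma eps_transpose (X : C) (Y : D) (f : hom (F X) Y) :
  eps Y ∘ fmap F (fmap G f ∘ eta X) = f.
Proof.
by rewrite fmapM compA -counit_adj_nat -compA adj_triangle_l compm1.
Qed.

Lemma eps_mul (X Y : D) :
  eps (X ⊗ Y) ∘ fmap F (radj_mul X Y)
  = (eps X ⊗ₘ eps Y) ∘ tf_muli F (G X) (G Y).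
Proof. exact: eps_transpose. Qed.

Lemma eps_one : eps (one D) ∘ fmap F radj_one = tf_onei F.
Proof. exact: eps_transpose. Qed.

Lemma tf_mul_epi (X Y : C) (W : D) (f g : hom (F (X ⊗ Y)) W) :
  f ∘ lax_mul F X Y = g ∘ lax_mul F X Y -> f = g.
Proof.
move=> /(congr1 (fun h => h ∘ tf_muli F X Y)).
by rewrite -!compA !tf_muliK !compm1.
Qed.

Lemma eps_mulE (X Y : D) :
  eps (X ⊗ Y) ∘ fmap F (radj_mul X Y) ∘ lax_mul F (G X) (G Y)
  = eps X ⊗ₘ eps Y.
Proof. by rewrite eps_mul -compA tf_mulK compm1. Qed.

Lemma eps_mul_tens (X Y : C) (X' Y' : D) (f : hom X (G X')) (g : hom Y (G Y')) :
  eps (X' ⊗ Y') ∘ fmap F (radj_mul X' Y' ∘ (f ⊗ₘ g)) ∘ lax_mul F X Y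
  = (eps X' ∘ fmap F f) ⊗ₘ (eps Y' ∘ fmap F g).
Proof. by rewrite fmapM -!compA -lax_mul_nat !compA eps_mulE -tensmM. Qed.

Lemma radj_mul_nat (X X' Y Y' : D) (f : hom X X') (g : hom Y Y') :
  radj_mul X' Y' ∘ (fmap G f ⊗ₘ fmap G g) = fmap G (f ⊗ₘ g) ∘ radj_mul X Y.
Proof.
apply: radj_inj; apply: tf_mul_epi.
rewrite eps_mul_tens -!counit_adj_nat tensmM.
by rewrite fmapM !compA -counit_adj_nat -!compA (compA (eps _)) eps_mulE.
Qed.

Lemma radj_mulA (X Y Z : D) :
  fmap G (assoc X Y Z) ∘ radj_mul (X ⊗ Y) Z ∘ (radj_mul X Y ⊗ₘ idm (G Z))
  = radj_mul X (Y ⊗ Z) ∘ (idm (G X) ⊗ₘ radj_mul Y Z)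
    ∘ assoc (G X) (G Y) (G Z).
Proof.
apply: radj_inj; apply: tf_mul_epi.
have iso_epi W (f g : hom (F (G X ⊗ G Y) ⊗ F (G Z)) W) :
    f ∘ (lax_mul F (G X) (G Y) ⊗ₘ idm _)
    = g ∘ (lax_mul F (G X) (G Y) ⊗ₘ idm _) -> f = g.
  move=> /(congr1 (fun h => h ∘ (tf_muli F (G X) (G Y) ⊗ₘ idm _))).
  by rewrite -!compA -!tensm1M tf_muliK !tensm1 !compm1.
apply: iso_epi; transitivity (assoc X Y Z ∘ ((eps X ⊗ₘ eps Y) ⊗ₘ eps Z)).
  rewrite -(compA (fmap G _)) fmapM (compA (eps _)) -counit_adj_nat.
  rewrite -!compA; congr (_ ∘ _); rewrite !compA eps_mul_tens -tensmM.
  by rewrite eps_mulE fmap1 !compm1.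
rewrite (fmapM F _ (assoc _ _ _)) -!compA (compA (fmap F (assoc _ _ _))).
rewrite lax_mulA !compA eps_mul_tens -tensmM eps_mulE fmap1 !compm1.
by rewrite assoc_nat.
Qed.

Lemma radj_mul1l (X : D) :
  fmap G (lunit X) ∘ radj_mul (one D) X ∘ (radj_one ⊗ₘ idm (G X))
  = lunit (G X).
Proof.
apply: radj_inj; apply: tf_mul_epi.
have iso_epi W (f g : hom (F (one C) ⊗ F (G X)) W) :
    f ∘ (lax_one F ⊗ₘ idm _) = g ∘ (lax_one F ⊗ₘ idm _) -> f = g.
  move=> /(congr1 (fun h => h ∘ (tf_onei F ⊗ₘ idm _))).
  by rewrite -!compA -!tensm1M tf_oneiK !tensm1 !compm1.
apply: iso_epi.
rewrite -(compA (fmap G _)) fmapM (compA (eps _)) -counit_adj_nat.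
rewrite -[RHS]compA -[RHS]compA (compA (fmap F (lunit _))) lax_mul1l.
rewrite -2!(compA (lunit X)) eps_mul_tens -compA -tensmM eps_one tf_oneK.
by rewrite fmap1 !compm1 lunit_nat.
Qed.

Lemma radj_mul1r (X : D) :
  fmap G (runit X) ∘ radj_mul X (one D) ∘ (idm (G X) ⊗ₘ radj_one)
  = runit (G X).
Proof.
apply: radj_inj; apply: tf_mul_epi.
have iso_epi W (f g : hom (F (G X) ⊗ F (one C)) W) :
    f ∘ (idm _ ⊗ₘ lax_one F) = g ∘ (idm _ ⊗ₘ lax_one F) -> f = g.
  move=> /(congr1 (fun h => h ∘ (idm _ ⊗ₘ tf_onei F))).
  by rewrite -!compA -!tens1mM tf_oneiK !tensm1 !compm1.
apply: iso_epi.
rewrite -(compA (fmap G _)) fmapM (compA (eps _)) -counit_adj_nat.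
rewrite -[RHS]compA -[RHS]compA (compA (fmap F (runit _))) lax_mul1r.
rewrite -2!(compA (runit X)) eps_mul_tens -compA -tensmM eps_one tf_oneK.
by rewrite fmap1 !compm1 runit_nat.
Qed.

(* The lax structure on the right adjoint is the mate of the (inverse of the)
   strong structure on F. *)
Definition radj_lax : laxFunctor D C :=
  LaxFunctor radj_mul_nat radj_mulA radj_mul1l radj_mul1r.

End AdjointLax.

Record algebra (k : fieldType) (C : monCat k) := Algebra {
  alg_obj :> C;
  alg_mul : hom (alg_obj ⊗ alg_obj) alg_obj;
  alg_one : hom (one C) alg_obj;
  alg_mulA : alg_mul ∘ (alg_mul ⊗ₘ idm alg_obj)
    = alg_mul ∘ (idm alg_obj ⊗ₘ alg_mul) ∘ assoc alg_obj alg_obj alg_obj;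
  alg_mul1l : alg_mul ∘ (alg_one ⊗ₘ idm alg_obj) = lunit alg_obj;
  alg_mul1r : alg_mul ∘ (idm alg_obj ⊗ₘ alg_one) = runit alg_obj
}.
Arguments alg_mul {k C} A : rename.
Arguments alg_one {k C} A : rename.

Section LaxAlgebra.
Variables (k : fieldType) (C D : monCat k) (G : laxFunctor C D).
Variable A : algebra C.

Let mul := fmap G (alg_mul A) ∘ lax_mul G A A.
Let unit := fmap G (alg_one A) ∘ lax_one G.

Lemma lax_algebra_mulA :
  mul ∘ (mul ⊗ₘ idm (G A)) = mul ∘ (idm (G A) ⊗ₘ mul) ∘ assoc _ _ _.
Proof.
rewrite /mul tensm1M tens1mM -(fmap1 G A) !compA.
rewrite -(compA (fmap G (alg_mul A)) (lax_mul G A A)) lax_mul_nat.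
rewrite -(compA (fmap G (alg_mul A)) (lax_mul G A A)) lax_mul_nat.
rewrite !(compA (fmap G (alg_mul A))) -!fmapM alg_mulA fmapM fmap1 -!compA.
by congr (_ ∘ _); rewrite !compA lax_mulA.
Qed.

Lemma lax_algebra_mul1l : mul ∘ (unit ⊗ₘ idm (G A)) = lunit (G A).
Proof.
rewrite /mul /unit tensm1M -{1}(fmap1 G A) compA.
rewrite -(compA (fmap G (alg_mul A))) lax_mul_nat compA -fmapM alg_mul1l.
by rewrite lax_mul1l.
Qed.

Lemma lax_algebra_mul1r : mul ∘ (idm (G A) ⊗ₘ unit) = runit (G A).
Proof.
rewrite /mul /unit tens1mM -{1}(fmap1 G A) compA.
rewrite -(compA (fmap G (alg_mul A))) lax_mul_nat compA -fmapM alg_mul1r.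
by rewrite lax_mul1r.
Qed.

Definition lax_algebra : algebra D :=
  Algebra lax_algebra_mulA lax_algebra_mul1l lax_algebra_mul1r.

End LaxAlgebra.

Record rmod (k : fieldType) (C : monCat k) (A : algebra C) := RMod {
  rmod_obj :> C;
  ract : hom (rmod_obj ⊗ A) rmod_obj;
  ractM : ract ∘ (ract ⊗ₘ idm A)
    = ract ∘ (idm rmod_obj ⊗ₘ alg_mul A) ∘ assoc rmod_obj A A;
  ract1 : ract ∘ (idm rmod_obj ⊗ₘ alg_one A) = runit rmod_obj
}.
Arguments ract {k C A} M : rename.

Section RModHom.
Variables (k : fieldType) (C : monCat k) (A : algebra C) (M N : rmod A).

Definition rmod_morph : {pred hom (M : C) N} :=
  [pred f | f ∘ ract M == ract N ∘ (f ⊗ₘ idm A)].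

Lemma rmod_morph_submod : submod_closed rmod_morph.
Proof.
have cl := @comp_linearl k C; have cr := @comp_linearr k C.
have tl := @tensm_linearl k C.
split.
  by rewrite inE (linear_at0 (cl _ _ _ _)) (linear_at0 (tl _ _ _ _ _))
    (linear_at0 (cr _ _ _ _)).
move=> a f g; rewrite !inE => /eqP Hf /eqP Hg.
by rewrite cl tl cr Hf Hg.
Qed.

HB.instance Definition _ :=
  GRing.isSubmodClosed.Build k (hom (M : C) N) rmod_morph rmod_morph_submod.

Record rmodHom := RModHom {
  rmod_hom :> hom (M : C) N;
  _ : rmod_hom \in rmod_morph
}.

HB.instance Definition _ := [isSub for rmod_hom].
HB.instance Definition _ := [Choice of rmodHom by <:].
HB.instance Definition _ := [SubChoice_isSubLmodule of rmodHom by <:].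

End RModHom.


Section RModCat.
Variables (k : fieldType) (C : monCat k) (A : algebra C).
Implicit Types M N P : rmod A.

Lemma rmod_homP M N (f : rmodHom M N) : f ∘ ract M = ract N ∘ (f ⊗ₘ idm A).
Proof. by case: f => f /=; rewrite inE => /eqP. Qed.

Lemma rmod_hom_inj M N (f g : rmodHom M N) : (f : hom (M : C) N) = g -> f = g.
Proof. exact: val_inj. Qed.

Definition mk_rmodHom M N (f : hom (M : C) N)
    (fP : f ∘ ract M = ract N ∘ (f ⊗ₘ idm A)) : rmodHom M N :=
  @RModHom k C A M N f (introT eqP fP).

Lemma rmod_idm_subproof M : idm (M : C) ∘ ract M = ract M ∘ (idm (M : C) ⊗ₘ idm A).
Proof. by rewrite tensm1 comp1m compm1. Qed.

Definition rmod_idm M := mk_rmodHom (rmod_idm_subproof M).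

Lemma rmod_comp_subproof M N P (g : rmodHom N P) (f : rmodHom M N) :
  ((g : hom (N : C) P) ∘ f) ∘ ract M
  = ract P ∘ (((g : hom (N : C) P) ∘ f) ⊗ₘ idm A).
Proof. by rewrite tensm1M -compA rmod_homP !compA rmod_homP. Qed.

Definition rmod_comp M N P (g : rmodHom N P) (f : rmodHom M N) :=
  mk_rmodHom (rmod_comp_subproof g f).

Definition rmod_linCat : linCat k.
Proof.
refine (@LinCat k (rmod A) (fun M N => rmodHom M N) rmod_idm rmod_comp
  _ _ _ _ _).
- by move=> M N f; apply: rmod_hom_inj; apply: comp1m.
- by move=> M N f; apply: rmod_hom_inj; apply: compm1.
- by move=> M N P Q h g f; apply: rmod_hom_inj; apply: compA.
- by move=> M N P f a g h; apply: rmod_hom_inj; apply: comp_linearl.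
- by move=> M N P g a f h; apply: rmod_hom_inj; apply: comp_linearr.
Defined.

End RModCat.

(* The underlying category is not required to be abelian: exactness only uses
   projectivity, which is lifting against categorical epimorphisms. *)
Record modCat (k : fieldType) (C : monCat k) := ModCat {
  mod_cat :> linCat k;
  act : C -> mod_cat -> mod_cat;
  actm : forall (X X' : C) (M M' : mod_cat),
    hom X X' -> hom M M' -> hom (act X M) (act X' M');
  actm1 : forall X M, actm (idm X) (idm M) = idm (act X M);
  actmM : forall (X X' X'' : C) (M M' M'' : mod_cat)
      (f' : hom X' X'') (f : hom X X') (g' : hom M' M'') (g : hom M M'),
    actm (f' ∘ f) (g' ∘ g) = actm f' g' ∘ actm f g;
  actm_linearl : forall (X X' : C) (M M' : mod_cat) (g : hom M M'),
    linear (fun f : hom X X' => actm f g);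
  actm_linearr : forall (X X' : C) (M M' : mod_cat) (f : hom X X'),
    linear (fun g : hom M M' => actm f g);
  act_assoc : forall (X Y : C) (M : mod_cat),
    hom (act (X ⊗ Y) M) (act X (act Y M));
  act_assoc_iso : forall X Y M, is_iso (act_assoc X Y M);
  act_assoc_nat : forall (X X' Y Y' : C) (M M' : mod_cat)
      (f : hom X X') (g : hom Y Y') (h : hom M M'),
    act_assoc X' Y' M' ∘ actm (f ⊗ₘ g) h
    = actm f (actm g h) ∘ act_assoc X Y M;
  act_unit : forall M : mod_cat, hom (act (one C) M) M;
  act_unit_iso : forall M, is_iso (act_unit M);
  act_unit_nat : forall (M M' : mod_cat) (h : hom M M'),
    act_unit M' ∘ actm (idm (one C)) h = h ∘ act_unit M;
  act_pentagon : forall (X Y Z : C) (M : mod_cat),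
    act_assoc X Y (act Z M) ∘ act_assoc (X ⊗ Y) Z M
    = actm (idm X) (act_assoc Y Z M) ∘ act_assoc X (Y ⊗ Z) M
      ∘ actm (assoc X Y Z) (idm M);
  act_triangle : forall (X : C) (M : mod_cat),
    actm (idm X) (act_unit M) ∘ act_assoc X (one C) M
    = actm (runit X) (idm M)
}.
Arguments act {k C M} : rename.
Notation "X ▷ M" := (act X M) : cat_scope.

Definition exact_modCat (k : fieldType) (C : monCat k) (M : modCat C) : Prop :=
  forall (P : C) (m : M), projective P -> projective (P ▷ m).

Section RModModCat.
Variables (k : fieldType) (C : monCat k) (A : algebra C).
Implicit Types (X Y Z : C) (M N : rmod A).

Let ractX X M : hom (X ⊗ M ⊗ A) (X ⊗ M) := (idm X ⊗ₘ ract M) ∘ assoc X M A.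

Lemma rmod_act_ractM X M : ractX X M ∘ (ractX X M ⊗ₘ idm A)
  = ractX X M ∘ (idm (X ⊗ M) ⊗ₘ alg_mul A) ∘ assoc (X ⊗ M) A A.
Proof.
rewrite /ractX tensm1M -(tensm1 X M) -!compA (compA (assoc X M A) (_ ⊗ₘ _)).
rewrite assoc_nat !compA -tens1mM ractM -(compA (idm X ⊗ₘ _) (assoc X M A)).
by rewrite assoc_nat -!compA pentagon !compA -!tens1mM.
Qed.

Lemma rmod_act_ract1 X M :
  ractX X M ∘ (idm (X ⊗ M) ⊗ₘ alg_one A) = runit (X ⊗ M).
Proof.
by rewrite /ractX -(tensm1 X M) -compA assoc_nat compA -tens1mM ract1 runit_tens.
Qed.

Definition rmod_act X M : rmod A := RMod (rmod_act_ractM X M) (rmod_act_ract1 X M).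

Lemma rmod_actm_subproof X X' M N (f : hom X X') (g : rmodHom M N) :
  (f ⊗ₘ g) ∘ ract (rmod_act X M) = ract (rmod_act X' N) ∘ ((f ⊗ₘ g) ⊗ₘ idm A).
Proof.
rewrite /= /ractX compA -tensmM compm1 rmod_homP -compA assoc_nat compA.
by rewrite -tensmM comp1m.
Qed.

Definition rmod_actm X X' M N (f : hom X X') (g : rmodHom M N) :
  rmodHom (rmod_act X M) (rmod_act X' N) :=
  @mk_rmodHom k C A (rmod_act X M) (rmod_act X' N) _ (rmod_actm_subproof f g).

Lemma rmod_assoc_subproof X Y M :
  assoc X Y M ∘ ract (rmod_act (X ⊗ Y) M)
  = ract (rmod_act X (rmod_act Y M)) ∘ (assoc X Y M ⊗ₘ idm A).
Proof.
rewrite /= /ractX -(tensm1 X Y) compA assoc_nat -compA pentagon.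
by rewrite !compA -tens1mM.
Qed.

Definition rmod_assoc X Y M :=
  @mk_rmodHom k C A (rmod_act (X ⊗ Y) M) (rmod_act X (rmod_act Y M)) _
    (rmod_assoc_subproof X Y M).

Lemma rmod_associ_subproof X Y M :
  associ X Y M ∘ ract (rmod_act X (rmod_act Y M))
  = ract (rmod_act (X ⊗ Y) M) ∘ (associ X Y M ⊗ₘ idm A).
Proof.
have /= assocP := rmod_assoc_subproof X Y M.
apply: assoc_mono; rewrite /= [LHS]compA associK comp1m [RHS]compA assocP -[RHS]compA.
by rewrite -tensm1M associK tensm1 compm1.
Qed.

Definition rmod_associ X Y M :=
  @mk_rmodHom k C A (rmod_act X (rmod_act Y M)) (rmod_act (X ⊗ Y) M) _
    (rmod_associ_subproof X Y M).

Lemma rmod_lunit_subproof M :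
  lunit M ∘ ract (rmod_act (one C) M) = ract M ∘ (lunit M ⊗ₘ idm A).
Proof. by rewrite /= /ractX compA lunit_nat -compA lunit_tens. Qed.

Definition rmod_lunit M :=
  @mk_rmodHom k C A (rmod_act (one C) M) M _ (rmod_lunit_subproof M).

Lemma rmod_luniti_subproof M :
  luniti M ∘ ract M = ract (rmod_act (one C) M) ∘ (luniti M ⊗ₘ idm A).
Proof.
have inj W (f g : hom W (one C ⊗ M)) : lunit M ∘ f = lunit M ∘ g -> f = g.
  by move=> /(congr1 (comp (luniti M))); rewrite !compA lunitK !comp1m.
have /= lunitP := rmod_lunit_subproof M.
apply: inj; rewrite /= [LHS]compA lunitiK comp1m [RHS]compA lunitP -[RHS]compA.
by rewrite -tensm1M lunitiK tensm1 compm1.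
Qed.

Definition rmod_luniti M :=
  @mk_rmodHom k C A M (rmod_act (one C) M) _ (rmod_luniti_subproof M).

(* X ▷ M is X ⊗ M with A acting on the right factor M. *)
Definition rmod_modCat : modCat C.
Proof.
refine (@ModCat k C (rmod_linCat A) rmod_act rmod_actm _ _ _ _
  rmod_assoc _ _ rmod_lunit _ _ _ _).
- by move=> X M; apply: rmod_hom_inj; apply: tensm1.
- by move=> *; apply: rmod_hom_inj; apply: tensmM.
- by move=> X X' M M' g a f h; apply: rmod_hom_inj; apply: tensm_linearl.
- by move=> X X' M M' f a g h; apply: rmod_hom_inj; apply: tensm_linearr.
- move=> X Y M; exists (rmod_associ X Y M).
  by split; apply: rmod_hom_inj; [apply: assocK | apply: associK].
- by move=> *; apply: rmod_hom_inj; apply: assoc_nat.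
- move=> M; exists (rmod_luniti M).
  by split; apply: rmod_hom_inj; [apply: lunitK | apply: lunitiK].
- by move=> *; apply: rmod_hom_inj; apply: lunit_nat.
- by move=> *; apply: rmod_hom_inj; apply: pentagon.
- by move=> *; apply: rmod_hom_inj; apply: triangle.
Defined.

Definition exact_algebra : Prop := exact_modCat rmod_modCat.

End RModModCat.

(* Main.v *)
(* Write B = F^ra(A).  The counit F(B) -> A induces bijections
   Hom_C(c, P ⊗ (c' ⊗ B)) = Hom_D(F c, F P ⊗ (F c' ⊗ A)), because F preserves
   duals; hence maps between the B-modules P ⊗ (c ⊗ B) correspond functorially
   to maps between the A-modules F P ⊗ (F c ⊗ A).

   For a projective P in C the object F P is projective, as F^ra is exact.  Let
   u be a map of free B-modules, U the corresponding map of free A-modules.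
   Exactness of A makes F P ⊗ coker U projective, so F P ⊗ U is von Neumann
   regular, i.e. of the form f with f r f = f.  This equational property goes
   back to P ⊗ u.  Applied to a presentation u of a B-module M, it shows that
   P ⊗ M = coker (P ⊗ u) is a retract of a projective free module. *)

From mathcomp Require Import all_boot all_algebra.
(* Imported last, so that [hom] and [comp] are those of [linCat]. *)
Require Import Defs.

Set Implicit Arguments.
Unset Strict Implicit.
Unset Printing Implicit Defensive.

Import GRing.Theory.
Local Open Scope ring_scope.
Local Open Scope cat_scope.

(** * Linear and abelian categories: epimorphisms, cokernels and projectives *)

Lemma linear_atB (k : fieldType) (U V : lmodType k) (f : U -> V) :
  linear f -> forall x y, f (x - y) = f x - f y.
Proof.
move=> lin_f x y; have := lin_f (-1) y x.
by rewrite !scaleN1r -!(addrC _ (- _)).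
Qed.

Section LinearCategory.
Variables (k : fieldType) (C : linCat k).
Implicit Types X Y Z W P Q : C.

Lemma comp0m X Y Z (f : hom X Y) : (0 : hom Y Z) ∘ f = 0.
Proof. exact: (linear_at0 (@comp_linearl _ _ _ _ _ f)). Qed.

Lemma compm0 X Y Z (g : hom Y Z) : g ∘ (0 : hom X Y) = 0.
Proof. exact: (linear_at0 (@comp_linearr _ _ _ _ _ g)). Qed.

Lemma compBl X Y Z (f : hom X Y) (g h : hom Y Z) :
  (g - h) ∘ f = g ∘ f - h ∘ f.
Proof. exact: (linear_atB (@comp_linearl _ _ _ _ _ f)). Qed.

Lemma compBr X Y Z (g : hom Y Z) (f h : hom X Y) :
  g ∘ (f - h) = g ∘ f - g ∘ h.
Proof. exact: (linear_atB (@comp_linearr _ _ _ _ _ g)). Qed.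

(** Composites nest to the left, so [g ∘ f] is not a subterm of [h ∘ g ∘ f]; this form lets an
    equation between such inner factors be used for rewriting. *)
Lemma comp_mid W X X' Y (g : hom X Y) (f : hom W X)
    (g' : hom X' Y) (f' : hom W X') :
  g ∘ f = g' ∘ f' -> forall Z (h : hom Y Z), h ∘ g ∘ f = h ∘ g' ∘ f'.
Proof. by move=> gf Z h; rewrite -!compA gf. Qed.

Lemma comp_mid3 V W W' X X' Y (g : hom X Y) (f : hom W X) (e : hom V W)
    (g' : hom X' Y) (f' : hom W' X') (e' : hom V W') :
  g ∘ f ∘ e = g' ∘ f' ∘ e' ->
  forall Z (h : hom Y Z), h ∘ g ∘ f ∘ e = h ∘ g' ∘ f' ∘ e'.
Proof. by rewrite -!compA => gfe Z h; rewrite -!compA gfe. Qed.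

Lemma comp_idr X Y (g : hom X Y) (f : hom Y X) :
  g ∘ f = idm Y -> forall Z (h : hom Y Z), h ∘ g ∘ f = h.
Proof. by move=> gf Z h; rewrite -compA gf compm1. Qed.

Lemma is_iso_comp X Y Z (g : hom Y Z) (f : hom X Y) :
  is_iso g -> is_iso f -> is_iso (g ∘ f).
Proof.
move=> [g' [g'g gg']] [f' [f'f ff']]; exists (f' ∘ g'); split.
  by rewrite -compA (compA g') g'g comp1m f'f.
by rewrite -compA (compA f) ff' comp1m gg'.
Qed.

Lemma iso_epi X Y (f : hom X Y) : is_iso f -> epi f.
Proof.
move=> [f' [_ ff']] Z g h /(congr1 (fun m => m ∘ f')).
by rewrite -!compA ff' !compm1.
Qed.

Lemma kernel_mono X Y Z (i : hom X Y) (f : hom Y Z) : is_kernel i f -> mono i.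
Proof.
move=> [fi0 ker_i] W g h gh.
have [|u [_ u_uniq]] := ker_i W (i ∘ h); first by rewrite compA fi0 comp0m.
by rewrite -(u_uniq g gh) (u_uniq h).
Qed.

Lemma cokernel_epi X Y Z (f : hom X Y) (q : hom Y Z) : is_cokernel q f -> epi q.
Proof.
move=> [qf0 cok_q] W g h gh.
have [|u [_ u_uniq]] := cok_q W (h ∘ q); first by rewrite -compA qf0 compm0.
by rewrite -(u_uniq g gh) (u_uniq h).
Qed.

Lemma epi_cokernel0 X Y Z (f : hom X Y) (q : hom Y Z) :
  is_cokernel q f -> q = 0 -> epi f.
Proof.
move=> [_ cok_q] q0 W g h gh; apply/eqP; rewrite -subr_eq0; apply/eqP.
have [|u [<- _]] := cok_q W (g - h); first by rewrite compBl gh subrr.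
by rewrite q0 compm0.
Qed.

(** [e] is the cokernel of some [g], and [g] factors through the kernel [i]; so a map killing [i]
    kills [g]. *)
Lemma epi_cokernel_kernel K X Y (e : hom X Y) (i : hom K X) :
  is_abelian C -> epi e -> is_kernel i e -> is_cokernel e i.
Proof.
move=> abC epi_e [ei0 ker_i]; split=> // Z h hi0.
have [W [g [eg0 cok_e]]] := abelian_epi abC epi_e.
have [v [iv _]] := ker_i _ g eg0.
by apply: cok_e; rewrite -iv compA hi0 comp0m.
Qed.

(** Write [f = j ∘ p] with [j] the kernel of [q]. Then [p] is epi, and [g], which factors through
    [j], lifts along [p]. *)
Lemma projective_exact_lift X Y Z P (f : hom X Y) (q : hom Y Z) (g : hom P Y) :
  is_abelian C -> is_cokernel q f -> projective P -> q ∘ g = 0 ->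
  exists h, f ∘ h = g.
Proof.
move=> abC [qf0 cok_q] projP qg0.
have [I [j ker_j]] := abelian_kernel abC q.
have mono_j := kernel_mono ker_j; have [qj0 univ_j] := ker_j.
have [p [jp _]] := univ_j _ _ qf0.
suff epi_p : epi p.
  have [g1 [jg1 _]] := univ_j _ _ qg0.
  have [h ph] := projP _ _ _ g1 epi_p.
  by exists h; rewrite -jp -compA ph.
have [W [c cok_c]] := abelian_cokernel abC p; have [cp0 _] := cok_c.
apply: (epi_cokernel0 cok_c).
have [I' [m ker_m]] := abelian_kernel abC c; have [cm0 univ_m] := ker_m.
have [p' [mp' _]] := univ_m _ _ cp0.
(* It suffices that [m], the image of [p], has a right inverse. A map [w] with kernel [j ∘ m] kills
   [f], so it factors through [q] and kills [j]; hence [j] factors through [j ∘ m]. *)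
have mono_jm : mono (j ∘ m).
  move=> V x y; rewrite -!compA => /mono_j; exact: (kernel_mono ker_m).
have [V [w [wjm0 univ_jm]]] := abelian_mono abC mono_jm.
have [|v [vq _]] := cok_q _ w.
  by rewrite -jp -mp' (compA j) compA wjm0 comp0m.
have [|n [jmn _]] := univ_jm _ j; first by rewrite -vq -compA qj0 compm0.
have mn1 : m ∘ n = idm I by apply: mono_j; rewrite compA jmn compm1.
by rewrite -(compm1 c) -mn1 compA cm0 comp0m.
Qed.

Lemma projective_retract P Q (s : hom P Q) (p : hom Q P) :
  p ∘ s = idm P -> projective Q -> projective P.
Proof.
move=> ps1 projQ X Y e f epi_e; have [g eg] := projQ _ _ e (f ∘ p) epi_e.
by exists (g ∘ s); rewrite compA eg -compA ps1 compm1.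
Qed.

End LinearCategory.

Lemma exact_functor_epi (k : fieldType) (C D : linCat k) (F : functor C D)
    (X Y : C) (e : hom X Y) :
  is_abelian C -> exact_functor F -> epi e -> epi (fmap F e).
Proof.
move=> abC exF epi_e; have [K [i ker_i]] := abelian_kernel abC e.
have cok_e := epi_cokernel_kernel abC epi_e ker_i.
by have [_ /cokernel_epi] := exF _ _ _ _ _ (conj ker_i cok_e).
Qed.

(** Transposition turns lifting from [F P] along [e] into lifting from [P] along [R e], which is epi
    because [R] is exact. *)
Lemma left_adjoint_projective (k : fieldType) (C D : linCat k)
    (F : functor C D) (R : right_adjoint F) (P : C) :
  is_abelian D -> exact_functor R -> projective P -> projective (F P).
Proof.
move=> abD exR projP X Y e f epi_e.
have [g eg] := projP _ _ _ (fmap R f ∘ unit_adj R P)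
                 (exact_functor_epi abD exR epi_e).
exists (counit_adj R X ∘ fmap F g).
rewrite compA counit_adj_nat -compA -fmapM eg fmapM compA -counit_adj_nat.
by rewrite -compA adj_triangle_l compm1.
Qed.

(** * Monoidal categories and the reversed tensor product *)

Section Monoidal.
Variables (k : fieldType) (C : monCat k).
Implicit Types X Y Z W : C.

Lemma tensm0 X X' Y Y' (f : hom X X') : f ⊗ₘ (0 : hom Y Y') = 0.
Proof. exact: (linear_at0 (@tensm_linearr _ _ _ _ _ _ f)). Qed.

Lemma tensBl X X' Y Y' (g : hom Y Y') (f h : hom X X') :
  (f - h) ⊗ₘ g = (f ⊗ₘ g) - (h ⊗ₘ g).
Proof. exact: (linear_atB (@tensm_linearl _ _ _ _ _ _ g)). Qed.

Lemma tensBr X X' Y Y' (f : hom X X') (g h : hom Y Y') :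
  f ⊗ₘ (g - h) = (f ⊗ₘ g) - (f ⊗ₘ h).
Proof. exact: (linear_atB (@tensm_linearr _ _ _ _ _ _ f)). Qed.

Lemma assoc_iso X Y Z : is_iso (assoc X Y Z).
Proof. by exists (associ X Y Z); rewrite assocK associK. Qed.

Lemma associ_iso X Y Z : is_iso (associ X Y Z).
Proof. by exists (assoc X Y Z); rewrite assocK associK. Qed.

Lemma lunit_iso X : is_iso (lunit X).
Proof. by exists (luniti X); rewrite lunitK lunitiK. Qed.

Lemma runit_iso X : is_iso (runit X).
Proof. by exists (runiti X); rewrite runitK runitiK. Qed.

Lemma tens_iso X X' Y Y' (f : hom X X') (g : hom Y Y') :
  is_iso f -> is_iso g -> is_iso (f ⊗ₘ g).
Proof.
move=> [f' [f'f ff']] [g' [g'g gg']]; exists (f' ⊗ₘ g').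
by rewrite -!tensmM f'f ff' g'g gg' !tensm1.
Qed.

Lemma idm_iso X : is_iso (idm X).
Proof. by exists (idm X); rewrite comp1m. Qed.

Lemma associ_nat X X' Y Y' Z Z' (f : hom X X') (g : hom Y Y') (h : hom Z Z') :
  associ X' Y' Z' ∘ (f ⊗ₘ (g ⊗ₘ h)) = ((f ⊗ₘ g) ⊗ₘ h) ∘ associ X Y Z.
Proof.
apply: assoc_mono; rewrite !compA associK comp1m assoc_nat.
by rewrite -compA associK compm1.
Qed.

Lemma runiti_nat X Y (f : hom X Y) :
  (f ⊗ₘ idm (one C)) ∘ runiti X = runiti Y ∘ f.
Proof.
apply: (iso_epi (runit_iso X)).
by rewrite -!compA runitK compm1 -runit_nat compA runitK comp1m.
Qed.

Lemma luniti_nat X Y (f : hom X Y) :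
  (idm (one C) ⊗ₘ f) ∘ luniti X = luniti Y ∘ f.
Proof.
apply: (iso_epi (lunit_iso X)).
by rewrite -!compA lunitK compm1 -lunit_nat compA lunitK comp1m.
Qed.

End Monoidal.

Section Reverse.
Variables (k : fieldType) (C : monCat k).

Lemma rev_pentagon (W X Y Z : C) :
  associ (Z ⊗ Y) X W ∘ associ Z Y (X ⊗ W)
  = (associ Z Y X ⊗ₘ idm W) ∘ associ Z (Y ⊗ X) W
    ∘ (idm Z ⊗ₘ associ Y X W).
Proof.
apply: assoc_mono; apply: assoc_mono.
rewrite !compA -(compA _ (assoc _ _ _) (associ _ _ _)) associK compm1 associK.
rewrite pentagon -(compA _ (assoc _ _ _ ⊗ₘ _) (associ _ _ _ ⊗ₘ _)).
rewrite -tensm1M associK tensm1 compm1.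
by rewrite -(compA _ (assoc _ _ _)) associK compm1 -tens1mM associK tensm1.
Qed.

Lemma rev_triangle (X Y : C) :
  (runit Y ⊗ₘ idm X) ∘ associ Y (one C) X = idm Y ⊗ₘ lunit X.
Proof. by rewrite -triangle -compA associK compm1. Qed.

(* The monoidal category with the opposite tensor product: right-hand versions
   of statements on duals are obtained by applying the left-hand ones to it. *)
Definition rev_monCat : monCat k.
Proof.
refine (@MonCat k C (one C) (fun X Y => Y ⊗ X)
  (fun X X' Y Y' f g => g ⊗ₘ f) _ _ _ _
  (fun X Y Z => associ Z Y X) (fun X Y Z => assoc Z Y X) _ _ _
  (fun X => runit X) (fun X => runiti X) _ _ _
  (fun X => lunit X) (fun X => luniti X) _ _ _ _ _).
- by move=> *; apply: tensm1.
- by move=> *; apply: tensmM.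
- by move=> *; apply: tensm_linearr.
- by move=> *; apply: tensm_linearl.
- by move=> *; apply: associK.
- by move=> *; apply: assocK.
- by move=> *; apply: associ_nat.
- by move=> *; apply: runitK.
- by move=> *; apply: runitiK.
- by move=> *; apply: runit_nat.
- by move=> *; apply: lunitK.
- by move=> *; apply: lunitiK.
- by move=> *; apply: lunit_nat.
- by move=> *; apply: rev_pentagon.
- by move=> *; apply: rev_triangle.
Defined.

End Reverse.

(** * Coherence identities mixing [assoc] and [associ], as they occur in zigzags *)

Section Coherence.
Variables (k : fieldType) (C : monCat k).
Implicit Types X Y Z W : C.

Lemma associ_tens_assoc W X Y Z :
  associ W X (Y ⊗ Z) ∘ (idm W ⊗ₘ assoc X Y Z)
  = assoc (W ⊗ X) Y Z ∘ (associ W X Y ⊗ₘ idm Z) ∘ associ W (X ⊗ Y) Z.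
Proof.
apply: (iso_epi (tens_iso (idm_iso W) (associ_iso X Y Z))).
rewrite -!compA (compA (associ _ _ _ ⊗ₘ _)) -rev_pentagon.
by rewrite -tens1mM associK tensm1 compm1 compA associK comp1m.
Qed.

Lemma tens_associ_assoc W X Y Z :
  (idm W ⊗ₘ associ X Y Z) ∘ assoc W X (Y ⊗ Z)
  = assoc W (X ⊗ Y) Z ∘ (assoc W X Y ⊗ₘ idm Z) ∘ associ (W ⊗ X) Y Z.
Proof.
apply: (iso_epi (assoc_iso (W ⊗ X) Y Z)).
rewrite -[LHS]compA pentagon !compA -tens1mM assocK tensm1 comp1m.
by rewrite -[RHS]compA assocK compm1.
Qed.

Lemma associ_luniti X Y :
  associ X (one C) Y ∘ (idm X ⊗ₘ luniti Y) = runiti X ⊗ₘ idm Y.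
Proof.
apply: (iso_epi (tens_iso (runit_iso X) (idm_iso Y))).
rewrite -tensm1M runitK tensm1 -triangle -compA (compA (_ ⊗ₘ luniti _)).
by rewrite -tens1mM lunitK tensm1 comp1m assocK.
Qed.

Lemma associ_luniti_tens X Y :
  associ (one C) X Y ∘ luniti (X ⊗ Y) = luniti X ⊗ₘ idm Y.
Proof.
apply: (iso_epi (tens_iso (lunit_iso X) (idm_iso Y))).
rewrite -tensm1M lunitK tensm1 -lunit_tens -compA (compA (luniti _)).
by rewrite lunitK comp1m assocK.
Qed.

End Coherence.

(** * Duals and the adjunctions they induce *)

Section Duality.
Variables (k : fieldType) (C : monCat k) (X X' : C).
Variables (ev : hom (X' ⊗ X) (one C)) (coev : hom (one C) (X ⊗ X')).

(** [transp] and [untransp] are the two directions of the adjunction with left adjoint [X' ⊗ -] and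
    right adjoint [X ⊗ -]. *)
Definition transp (Y Z : C) (f : hom (X' ⊗ Y) Z) : hom Y (X ⊗ Z) :=
  (idm X ⊗ₘ f) ∘ (assoc X X' Y ∘ ((coev ⊗ₘ idm Y) ∘ luniti Y)).

Definition untransp (Y Z : C) (g : hom Y (X ⊗ Z)) : hom (X' ⊗ Y) Z :=
  lunit Z ∘ ((ev ⊗ₘ idm Z) ∘ (associ X' X Z ∘ (idm X' ⊗ₘ g))).

Lemma untranspE (Y Z : C) (g : hom Y (X ⊗ Z)) :
  untransp g = untransp (idm (X ⊗ Z)) ∘ (idm X' ⊗ₘ g).
Proof. by rewrite /untransp tensm1 compm1 -!compA. Qed.

Lemma transp_natr (Y Z Z' : C) (f : hom (X' ⊗ Y) Z) (g : hom Z Z') :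
  transp (g ∘ f) = (idm X ⊗ₘ g) ∘ transp f.
Proof. by rewrite /transp tens1mM -compA. Qed.

Hypothesis dual : is_left_dual ev coev.

Lemma transp_natl (Y Y' Z : C) (f : hom (X' ⊗ Y) Z) (h : hom Y' Y) :
  transp (f ∘ (idm X' ⊗ₘ h)) = transp f ∘ h.
Proof.
rewrite transp_natr /transp !compA (comp_mid (esym (luniti_nat _))).
rewrite (comp_mid (tensm_swap _ _)) -(tensm1 X X').
by rewrite (comp_mid (assoc_nat _ _ _)).
Qed.

(** Interchange moves [f] to the outside; what remains is the second zigzag tensored with [Y]. *)
Lemma transpK (Y Z : C) (f : hom (X' ⊗ Y) Z) : untransp (transp f) = f.
Proof.
have [_ /(congr1 (fun h => h ⊗ₘ idm Y))] := dual; rewrite tensm1 => zigzag.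
rewrite /untransp /transp !tens1mM.
rewrite (compA (associ _ _ _)) associ_nat -(compA _ (associ _ _ _)) tensm1.
rewrite (compA (ev ⊗ₘ _)) tensm_swap -compA (compA (lunit Z)) lunit_nat.
rewrite -compA -[RHS]compm1; congr (_ ∘ _); rewrite -[RHS]zigzag.
rewrite !tensm1M -lunit_tens (comp_mid (assoc_nat _ _ _)) tensm1 !compA.
rewrite (comp_mid (associ_tens_assoc _ _ _ _)) !compA.
by rewrite (comp_mid (associ_nat _ _ _)) -compA associ_luniti.
Qed.

(** Naturality reduces to the case where [g] is an identity, which is the first zigzag tensored with
    [Z]. *)
Lemma untranspK (Y Z : C) (g : hom Y (X ⊗ Z)) : transp (untransp g) = g.
Proof.
have [/(congr1 (fun h => h ⊗ₘ idm Z))] := dual; rewrite tensm1 => zigzag _.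
rewrite untranspE transp_natl -[RHS]comp1m; congr (_ ∘ _).
rewrite -[RHS]zigzag /transp /untransp tensm1 compm1 !tensm1M !tens1mM.
rewrite -triangle (comp_mid (assoc_nat _ _ _)) !compA.
rewrite (comp_mid (tens_associ_assoc _ _ _ _)) !compA -tensm1.
by rewrite (comp_mid (associ_nat _ _ _)) -compA associ_luniti_tens.
Qed.

Lemma transp_inj Y Z : injective (@transp Y Z).
Proof. exact: can_inj (@transpK Y Z). Qed.

Lemma dual_tens_epi (Y Y' : C) (e : hom Y Y') : epi e -> epi (idm X' ⊗ₘ e).
Proof.
move=> epi_e Z g h gh; apply: transp_inj; apply: epi_e.
by rewrite -!transp_natl gh.
Qed.

Lemma dual_tens_cokernel (W Y Z : C) (f : hom W Y) (q : hom Y Z) :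
  is_cokernel q f -> is_cokernel (idm X' ⊗ₘ q) (idm X' ⊗ₘ f).
Proof.
move=> cok_q; have [qf0 univ_q] := cok_q.
split=> [|V h hf0]; first by rewrite -tens1mM qf0 tensm0.
have [|u [uq _]] := univ_q _ (transp h).
  by rewrite -transp_natl hf0 /transp tensm0 comp0m.
exists (untransp u); split=> [|v vq].
  by apply: transp_inj; rewrite transp_natl untranspK.
apply: transp_inj; rewrite untranspK; apply: (cokernel_epi cok_q).
by rewrite uq -vq transp_natl.
Qed.

(** A left adjoint preserves projectives when its right adjoint, here [X ⊗ -], preserves
    epimorphisms. *)
Lemma tens_projective_dual (P : C) : projective P ->
  (forall Y Y' (e : hom Y Y'), epi e -> epi (idm X ⊗ₘ e)) ->
  projective (X' ⊗ P).
Proof.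
move=> projP tens_epi Y Z e f epi_e.
have [g eg] := projP _ _ _ (transp f) (tens_epi _ _ _ epi_e).
by exists (untransp g); apply: transp_inj; rewrite transp_natr untranspK.
Qed.

End Duality.

(** * Tensoring in a rigid category: epimorphisms, cokernels, projectives *)

Section Rigid.
Variables (k : fieldType) (C : monCat k).
Hypothesis rigidC : is_rigid C.
Implicit Types X Y Z W : C.

(** Reversing the tensor product exchanges left and right duals. *)
Lemma rev_rigid : is_rigid (rev_monCat C).
Proof.
move=> X; have [] := rigidC X.
move=> [X1 [ev1 [coev1 [z1 z1']]]] [X2 [ev2 [coev2 [z2 z2']]]].
split.
  by exists X2, ev2, coev2; split; rewrite /= -!compA; rewrite -!compA in z2 z2'.
by exists X1, ev1, coev1; split; rewrite /= -!compA; rewrite -!compA in z1 z1'.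
Qed.

(** A right dual of [X] has [X] as its left dual, which makes [X ⊗ -] a left adjoint. *)
Lemma tensl_epi X Y Z (e : hom Y Z) : epi e -> epi (idm X ⊗ₘ e).
Proof. by have [_ [X' [ev [coev /dual_tens_epi]]]] := rigidC X; apply. Qed.

Lemma tensl_cokernel X W Y Z (f : hom W Y) (q : hom Y Z) :
  is_cokernel q f -> is_cokernel (idm X ⊗ₘ q) (idm X ⊗ₘ f).
Proof. by have [_ [X' [ev [coev /dual_tens_cokernel]]]] := rigidC X; apply. Qed.

End Rigid.

Section RigidRight.
Variables (k : fieldType) (C : monCat k).
Hypothesis rigidC : is_rigid C.
Implicit Types X Y Z W : C.

Lemma tensr_epi X Y Z (e : hom Y Z) : epi e -> epi (e ⊗ₘ idm X).
Proof. exact: (@tensl_epi k (rev_monCat C) (rev_rigid rigidC) X Y Z e). Qed.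

Lemma tensr_cokernel X W Y Z (f : hom W Y) (q : hom Y Z) :
  is_cokernel q f -> is_cokernel (q ⊗ₘ idm X) (f ⊗ₘ idm X).
Proof.
exact: (@tensl_cokernel k (rev_monCat C) (rev_rigid rigidC) X W Y Z f q).
Qed.

(** [- ⊗ X] is left adjoint to [- ⊗ X'] for a suitable dual [X'], and the latter preserves
    epimorphisms by rigidity. *)
Lemma tensr_projective P X : projective P -> projective (P ⊗ X).
Proof.
move=> projP.
have [_ [X' [ev [coev dualX]]]] := rev_rigid rigidC X.
apply: (tens_projective_dual dualX projP) => Y Y' e.
exact: (@tensl_epi k (rev_monCat C) (rev_rigid rigidC)).
Qed.

End RigidRight.

(** * Tensor functors: structure maps and preservation of duals *)

Section TensorFunctor.
Variables (k : fieldType) (C D : monCat k) (F : tensorFunctor C D).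
Implicit Types X Y Z : C.

Lemma tf_mul_iso X Y : is_iso (lax_mul F X Y).
Proof. by exists (tf_muli F X Y); rewrite tf_mulK tf_muliK. Qed.

Lemma tf_muli_nat X X' Y Y' (f : hom X X') (g : hom Y Y') :
  tf_muli F X' Y' ∘ fmap F (f ⊗ₘ g)
  = (fmap F f ⊗ₘ fmap F g) ∘ tf_muli F X Y.
Proof.
apply: (iso_epi (tf_mul_iso X Y)).
by rewrite -!compA -lax_mul_nat tf_mulK compm1 compA tf_mulK comp1m.
Qed.

Lemma lax_mul_natl X X' Y (f : hom X X') :
  lax_mul F X' Y ∘ (fmap F f ⊗ₘ idm (F Y))
  = fmap F (f ⊗ₘ idm Y) ∘ lax_mul F X Y.
Proof. by rewrite -(fmap1 F Y) lax_mul_nat. Qed.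

Lemma lax_mul_natr X Y Y' (g : hom Y Y') :
  lax_mul F X Y' ∘ (idm (F X) ⊗ₘ fmap F g)
  = fmap F (idm X ⊗ₘ g) ∘ lax_mul F X Y.
Proof. by rewrite -(fmap1 F X) lax_mul_nat. Qed.

Lemma runit_onei X :
  runit (F X) ∘ (idm (F X) ⊗ₘ tf_onei F)
  = fmap F (runit X) ∘ lax_mul F X (one C).
Proof. by rewrite -lax_mul1r -compA -tens1mM tf_oneiK tensm1 compm1. Qed.

Lemma lunit_onei X :
  lunit (F X) ∘ (tf_onei F ⊗ₘ idm (F X))
  = fmap F (lunit X) ∘ lax_mul F (one C) X.
Proof. by rewrite -lax_mul1l -compA -tensm1M tf_oneiK tensm1 compm1. Qed.

Lemma one_luniti X :
  lax_mul F (one C) X ∘ ((lax_one F ⊗ₘ idm (F X)) ∘ luniti (F X))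
  = fmap F (luniti X).
Proof.
apply: (iso_epi (lunit_iso (F X))).
rewrite -!compA lunitK compm1 -lax_mul1l !compA -fmapM lunitK fmap1.
by rewrite comp1m.
Qed.

Lemma one_runiti X :
  lax_mul F X (one C) ∘ ((idm (F X) ⊗ₘ lax_one F) ∘ runiti (F X))
  = fmap F (runiti X).
Proof.
apply: (iso_epi (runit_iso (F X))).
rewrite -!compA runitK compm1 -lax_mul1r !compA -fmapM runitK fmap1.
by rewrite comp1m.
Qed.

Lemma lax_mulAi X Y Z :
  lax_mul F (X ⊗ Y) Z ∘ (lax_mul F X Y ⊗ₘ idm (F Z))
    ∘ associ (F X) (F Y) (F Z)
  = fmap F (associ X Y Z) ∘ lax_mul F X (Y ⊗ Z)
    ∘ (idm (F X) ⊗ₘ lax_mul F Y Z).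
Proof.
apply: (iso_epi (assoc_iso (F X) (F Y) (F Z))).
rewrite -compA assocK compm1 -!compA (compA (lax_mul F X _)) -lax_mulA.
by rewrite !compA -fmapM assocK fmap1 comp1m.
Qed.

(** Coherence slides the structure maps of [F] together until [lax_mul] cancels against [tf_muli];
    what remains is [F] applied to a zigzag of the given pair. *)
Lemma tf_left_dual X X' (ev : hom (X' ⊗ X) (one C))
    (coev : hom (one C) (X ⊗ X')) :
  is_left_dual ev coev ->
  is_left_dual (tf_onei F ∘ fmap F ev ∘ lax_mul F X' X)
               (tf_muli F X X' ∘ fmap F coev ∘ lax_one F).
Proof.
move=> [z z']; split.
  rewrite !tens1mM !tensm1M !compA runit_onei.
  rewrite (comp_mid (lax_mul_natr _ _)) -(comp_mid3 (lax_mulA _ _ _ _)).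
  have mulK : (lax_mul F X X' ⊗ₘ idm (F X)) ∘ (tf_muli F X X' ⊗ₘ idm (F X))
      = idm _.
    by rewrite -tensm1M tf_muliK tensm1.
  rewrite (comp_idr mulK) (comp_mid (lax_mul_natl _ _)) -!compA one_luniti.
  by rewrite -!fmapM !compA z fmap1.
rewrite !tens1mM !tensm1M !compA lunit_onei.
rewrite (comp_mid (lax_mul_natl _ _)) (comp_mid3 (lax_mulAi _ _ _)).
have mulK : (idm (F X') ⊗ₘ lax_mul F X X') ∘ (idm (F X') ⊗ₘ tf_muli F X X')
    = idm _.
  by rewrite -tens1mM tf_muliK tensm1.
rewrite (comp_idr mulK) (comp_mid (lax_mul_natr _ _)) -!compA one_runiti.
by rewrite -!fmapM !compA z' fmap1.
Qed.

End TensorFunctor.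

(** * Right modules: linear maps, free modules, cokernels, projectives *)

Section RModules.
Variables (k : fieldType) (C : monCat k) (A : algebra C).
Implicit Types (M N : rmod A) (c P X : C).

(** A predicate on maps of [C], beside the subtype [rmodHom], so that maps constructed in [C] can be
    shown linear afterwards. *)
Definition rlin M N (f : hom (M : C) N) : Prop :=
  f ∘ ract M = ract N ∘ (f ⊗ₘ idm A).

Lemma rlin_idm M : @rlin M M (idm (M : C)).
Proof. exact: rmod_idm_subproof. Qed.

Lemma rlin_comp M N N' (g : hom (N : C) N') (f : hom (M : C) N) :
  rlin g -> rlin f -> @rlin M N' (g ∘ f).
Proof.
rewrite /rlin => lin_g lin_f.
by rewrite tensm1M -compA lin_f !compA lin_g.
Qed.

Lemma rlinB M N (f g : hom (M : C) N) : rlin f -> rlin g -> rlin (f - g).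
Proof.
rewrite /rlin => lin_f lin_g.
by rewrite compBl tensBl compBr lin_f lin_g.
Qed.

Lemma rlin_inv M N (f : hom (M : C) N) (g : hom (N : C) M) :
  rlin f -> g ∘ f = idm _ -> f ∘ g = idm _ -> rlin g.
Proof.
rewrite /rlin => lin_f gf fg.
rewrite -[RHS]comp1m -gf -(compA g) (compA f) lin_f -!compA -tensm1M fg.
by rewrite tensm1 compm1.
Qed.

Lemma rlin_act P M N (f : hom (M : C) N) :
  rlin f -> @rlin (rmod_act P M) (rmod_act P N) (idm P ⊗ₘ f).
Proof. by move=> lin_f; apply: (rmod_actm_subproof _ (mk_rmodHom lin_f)). Qed.

Lemma rlin_actl P P' M (f : hom P P') :
  @rlin (rmod_act P M) (rmod_act P' M) (f ⊗ₘ idm (M : C)).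
Proof. exact: (rmod_actm_subproof f (rmod_idm M)). Qed.

Definition regular_rmod : rmod A := RMod (alg_mulA A) (alg_mul1r A).

Lemma rlin_ract M : @rlin (rmod_act M regular_rmod) M (ract M).
Proof. by rewrite /rlin /= ractM compA. Qed.

(* [c ⊗ A -> M] is invertible: [M] is the free module on [c]. *)
Definition basis c M (j : hom c (M : C)) : Prop :=
  is_iso (ract M ∘ (j ⊗ₘ idm A)).

Lemma basis_act P c M (j : hom c (M : C)) :
  basis j -> @basis (P ⊗ c) (rmod_act P M) (idm P ⊗ₘ j).
Proof.
rewrite /basis /= -compA assoc_nat compA -tens1mM => basis_j.
by apply: is_iso_comp; [apply: tens_iso; [apply: idm_iso|] | apply: assoc_iso].
Qed.

Lemma basis_regular : @basis (one C) regular_rmod (alg_one A).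
Proof. by rewrite /basis /= alg_mul1l; apply: lunit_iso. Qed.

(** Existence half of the universal property of free modules: the linear map [c ⊗ A -> N] induced by
    [g0] is transported along the inverse [v] of [c ⊗ A -> M]. *)
Lemma basis_ext c M N (j : hom c (M : C)) (g0 : hom c (N : C)) :
  basis j -> exists g : hom (M : C) N, rlin g /\ g ∘ j = g0.
Proof.
move=> [v [vj jv]].
have lin_jA (L : rmod A) (l : hom c (L : C)) :
    @rlin (rmod_act c regular_rmod) L (ract L ∘ (l ⊗ₘ idm A)).
  exact: rlin_comp (rlin_ract L) (rlin_actl regular_rmod l).
exists (ract N ∘ (g0 ⊗ₘ idm A) ∘ v); split.
  exact: rlin_comp (lin_jA _ _) (rlin_inv (lin_jA _ _) vj jv).
(* Inserting the unit of [A] restricts the induced map back to the generators. *)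
have jE (L : rmod A) (l : hom c (L : C)) :
    ract L ∘ (l ⊗ₘ idm A) ∘ ((idm c ⊗ₘ alg_one A) ∘ runiti c) = l.
  rewrite -compA (compA (l ⊗ₘ _)) tensm_swap !compA ract1 runit_nat -compA.
  by rewrite runitiK compm1.
by rewrite -{1}(jE M j) (compA _ (ract M ∘ _)) -(compA _ v) vj compm1 jE.
Qed.

Lemma basis_uniq c M N (j : hom c (M : C)) (g h : hom (M : C) N) :
  basis j -> rlin g -> rlin h -> g ∘ j = h ∘ j -> g = h.
Proof.
move=> basis_j lin_g lin_h gjhj; apply: (iso_epi basis_j).
by rewrite !compA lin_g lin_h -!compA -!tensm1M gjhj.
Qed.

Hypotheses (abC : is_abelian C) (rigidC : is_rigid C).

(** By rigidity [- ⊗ A] preserves cokernels, so the action of [N] descends to the cokernel taken in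
    [C]; the module axioms are checked after composing with epimorphisms built from [q]. *)
Lemma rmod_cokernel M N (f : hom (M : C) N) :
  rlin f -> exists (Q : rmod A) (q : hom (N : C) Q), rlin q /\ is_cokernel q f.
Proof.
move=> lin_f; have [Q [q cok_q]] := abelian_cokernel abC f.
have epi_q := cokernel_epi cok_q; have [qf0 univ_q] := cok_q.
have cok_qA := tensr_cokernel rigidC A cok_q; have [_ univ_qA] := cok_qA.
have [|r [rqA _]] := univ_qA _ (q ∘ ract N).
  by rewrite -compA -lin_f compA qf0 comp0m.
have epi_qA Y : epi (q ⊗ₘ idm Y) by apply: tensr_epi.
have rM : r ∘ (r ⊗ₘ idm A) = r ∘ (idm Q ⊗ₘ alg_mul A) ∘ assoc Q A A.
  apply: (tensr_epi rigidC (X := A) (epi_qA A)).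
  rewrite -compA -tensm1M rqA tensm1M compA rqA -!compA assoc_nat tensm1.
  by rewrite (compA (idm Q ⊗ₘ _)) -tensm_swap !compA rqA -!compA ractM !compA.
have r1 : r ∘ (idm Q ⊗ₘ alg_one A) = runit Q.
  apply: (epi_qA (one C)).
  by rewrite -compA -tensm_swap compA rqA -compA ract1 runit_nat.
by exists (RMod rM r1), q; split.
Qed.

(** The cokernel of [e] in [C] is a module map killing [e], hence zero. *)
Lemma rmod_epi (M N : rmod_linCat A) (e : hom M N) :
  epi e -> epi (rmod_hom e).
Proof.
move=> epi_e; have [Q [q [lin_q cok_q]]] := rmod_cokernel (rmod_homP e).
apply: (epi_cokernel0 cok_q).
pose q' : hom N (Q : rmod_linCat A) := mk_rmodHom lin_q.
suff /(congr1 val) : q' = 0 by [].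
apply: epi_e; rewrite comp0m; apply: val_inj; exact: cok_q.1.
Qed.

(** Lifting from a free module amounts to lifting its generators, which is possible in [C] by
    [rmod_epi]. *)
Lemma basis_projective c M (j : hom c (M : C)) :
  basis j -> projective c -> projective (M : rmod_linCat A).
Proof.
move=> basis_j projc X Y e f /rmod_epi epi_e.
have [g0 eg0] := projc _ _ _ (rmod_hom f ∘ j) epi_e.
have [g [lin_g gj]] := basis_ext g0 basis_j.
exists (mk_rmodHom lin_g); apply: rmod_hom_inj.
apply: (basis_uniq basis_j); last by rewrite /= -compA gj.
  exact: rlin_comp (rmod_homP e) lin_g.
exact: rmod_homP.
Qed.

(* Since [P ⊗ coker u] is projective, the image of [P ⊗ u] splits off. *)
Lemma exact_algebra_regular P c M N (u : hom (M : C) N) (j : hom c (N : C)) :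
  exact_algebra A -> projective P -> rlin u -> basis j ->
  exists r : hom (rmod_act P N : C) (rmod_act P M),
    rlin r /\ (idm P ⊗ₘ u) ∘ r ∘ (idm P ⊗ₘ u) = idm P ⊗ₘ u.
Proof.
move=> exA projP lin_u basis_j.
have [Q [q [lin_q cok_q]]] := rmod_cokernel lin_u.
have cok_Pq := tensl_cokernel rigidC P cok_q.
pose q' : hom (rmod_act P N : rmod_linCat A) (rmod_act P Q) :=
  mk_rmodHom (rlin_act P lin_q).
have epi_q' : epi q'.
  move=> Z g h /(congr1 val) /= gh; apply: val_inj.
  exact: (cokernel_epi cok_Pq gh).
have [s /(congr1 val) /= qs] := exA P Q projP _ _ q' (idm _) epi_q'.
have lin_s := rmod_homP s; move: (rmod_hom s) lin_s qs => {}s lin_s qs.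
(* [e] projects onto the kernel of [P ⊗ q], the image of [P ⊗ u]. On the projective generators
   [P ⊗ c] it lifts through [P ⊗ u]; extending linearly gives [r] with [(P ⊗ u) ∘ r = e], and [e]
   fixes [P ⊗ u]. *)
pose e := idm (P ⊗ N) - s ∘ (idm P ⊗ₘ q).
have lin_e : @rlin (rmod_act P N) (rmod_act P N) e.
  apply: rlinB (rlin_idm (rmod_act P N)) _.
  exact: rlin_comp lin_s (rlin_act P lin_q).
have qe0 : (idm P ⊗ₘ q) ∘ (e ∘ (idm P ⊗ₘ j)) = 0.
  by rewrite compA /e compBr compA qs comp1m compm1 subrr comp0m.
have [r0 ur0] :=
  projective_exact_lift abC cok_Pq (tensr_projective rigidC projP) qe0.
have [r [lin_r rj]] :=
  @basis_ext _ (rmod_act P N) (rmod_act P M) _ r0 (basis_act P basis_j).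
exists r; split=> //.
have -> : (idm P ⊗ₘ u) ∘ r = e.
  apply: (basis_uniq (basis_act P basis_j)) lin_e _; last by rewrite -compA rj.
  exact: rlin_comp (rlin_act P lin_u) lin_r.
by rewrite /e compBl comp1m -compA cok_Pq.1 compm0 subr0.
Qed.

End RModules.

(** * Semilinear and cartesian maps from [F M] to an [A]-module *)

Section Semilinear.
Variables (k : fieldType) (C D : monCat k) (F : tensorFunctor C D).
Variables (B : algebra C) (A : algebra D) (eps : hom (F B) (A : D)).
Implicit Types (M : rmod B) (N : rmod A) (X Y : C).

(** Linearity over [F B], acting on [N] through [eps], written out with [lax_mul] rather than
    through an image algebra [F B]. *)
Definition semilin M N (h : hom (F M) (N : D)) : Prop :=
  h ∘ fmap F (ract M) ∘ lax_mul F M B = ract N ∘ (h ⊗ₘ eps).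

(* Equivalently, the mate [M -> R N] of [h] under an adjunction [F -| R] is
   invertible. *)
Definition cartesian X (Y : D) (h : hom (F X) Y) : Prop :=
  forall W (g : hom (F W) Y), exists! f : hom W X, h ∘ fmap F f = g.

Lemma cartesian_inj X (Y : D) (h : hom (F X) Y) W (f g : hom W X) :
  cartesian h -> h ∘ fmap F f = h ∘ fmap F g -> f = g.
Proof.
move=> cart_h hfg; have [u [_ u_uniq]] := cart_h _ (h ∘ fmap F g).
by rewrite -(u_uniq f hfg) (u_uniq g).
Qed.

(** Composing with [h] after applying [F] is injective and translates [u] and [r] into [U] and [R],
    so the equation descends. *)
Lemma cartesian_regular X X' (Y Y' : D) (h : hom (F X) Y) (h' : hom (F X') Y')
    (u : hom X' X) (r : hom X X') (U : hom Y' Y) (R : hom Y Y') :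
  cartesian h -> h ∘ fmap F u = U ∘ h' -> h' ∘ fmap F r = R ∘ h ->
  U ∘ R ∘ U = U -> u ∘ r ∘ u = u.
Proof.
move=> cart_h hu h'r URU; apply: (cartesian_inj cart_h).
rewrite !fmapM !compA hu -(compA U) h'r -!compA hu.
by rewrite !compA URU.
Qed.

Lemma semilin_rlin M N N' (h : hom (F M) (N : D)) (g : hom (N : D) N') :
  semilin h -> rlin g -> @semilin M N' (g ∘ h).
Proof.
rewrite /semilin => semi_h lin_g.
by rewrite -!compA (compA h) semi_h compA lin_g -compA -tensmM comp1m.
Qed.

Lemma rlin_semilin M M' N (h : hom (F M') (N : D)) (f : hom (M : C) M') :
  semilin h -> rlin f -> @semilin M N (h ∘ fmap F f).
Proof.
rewrite /semilin => semi_h lin_f.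
rewrite -(compA h) -fmapM lin_f fmapM -!compA -lax_mul_natl.
by rewrite !compA semi_h -compA -tensmM compm1.
Qed.

(** [f] is the unique preimage of [g ∘ h]; its linearity is tested after composing with [h'], where
    it follows from that of [g]. *)
Lemma cartesian_lift M M' N N' (h : hom (F M) (N : D)) (h' : hom (F M') (N' : D))
    (g : hom (N : D) N') :
  semilin h -> semilin h' -> cartesian h' -> rlin g ->
  exists f : hom (M : C) M', rlin f /\ h' ∘ fmap F f = g ∘ h.
Proof.
move=> semi_h semi_h' cart_h' lin_g; have [f [h'f _]] := cart_h' _ (g ∘ h).
exists f; split=> //; apply: (cartesian_inj cart_h').
apply: (iso_epi (tf_mul_iso F M B)).
rewrite !fmapM !compA h'f (semilin_rlin semi_h lin_g).
rewrite -(compA (h' ∘ _)) -lax_mul_natl compA semi_h' -compA -tensmM.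
by rewrite h'f compm1.
Qed.

Lemma semilin_uniq c M N (j : hom c (M : C)) (h h' : hom (F M) (N : D)) :
  basis j -> semilin h -> semilin h' -> h ∘ fmap F j = h' ∘ fmap F j -> h = h'.
Proof.
rewrite /semilin => -[v [vj jv]] semi_h semi_h' hj.
(* Through [v] and [tf_muli], [F M] becomes [F c ⊗ F B], and semilinearity expresses [l] by its
   values on generators. *)
have hE (l : hom (F M) (N : D)) :
    l ∘ fmap F (ract M) ∘ lax_mul F M B = ract N ∘ (l ⊗ₘ eps) ->
    l = ract N ∘ ((l ∘ fmap F j) ⊗ₘ eps) ∘ (tf_muli F c B ∘ fmap F v).
  move=> semi_l; rewrite -{1}(compm1 l) -fmap1 -jv !fmapM -(compm1 eps) tensmM.
  rewrite (compA (ract N)) -semi_l -!compA; do 2 congr (_ ∘ _).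
  by rewrite (compA (lax_mul F _ _)) lax_mul_natl -compA (compA (lax_mul F _ _))
    tf_muliK comp1m.
by rewrite (hE h) // (hE h') // hj.
Qed.

Definition tens_semilin P X (Y : D) (h : hom (F X) Y) :
    hom (F (P ⊗ X)) (F P ⊗ Y) :=
  (idm (F P) ⊗ₘ h) ∘ tf_muli F P X.

Lemma tens_semilin_nat P X X' (Y Y' : D) (h : hom (F X) Y) (h' : hom (F X') Y')
    (u : hom X' X) (U : hom Y' Y) :
  h ∘ fmap F u = U ∘ h' ->
  tens_semilin P h ∘ fmap F (idm P ⊗ₘ u)
  = (idm (F P) ⊗ₘ U) ∘ tens_semilin P h'.
Proof.
move=> hu; rewrite /tens_semilin -compA tf_muli_nat fmap1 !compA -!tens1mM.
by rewrite hu.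
Qed.

Lemma semilin_act P M N (h : hom (F M) (N : D)) :
  semilin h -> @semilin (rmod_act P M) (rmod_act (F P) N) (tens_semilin P h).
Proof.
rewrite /semilin /tens_semilin /= => semi_h.
apply: (iso_epi (tens_iso (tf_mul_iso F P M) (idm_iso (F B)))).
rewrite fmapM !compA (comp_mid (tf_muli_nat _ _ _)).
rewrite (comp_mid3 (lax_mulA _ _ _ _)) (comp_idr (tf_mulK _ _ _)) fmap1.
rewrite -!tens1mM semi_h -[RHS]compA -tensmM -(compA _ (tf_muli _ _ _)).
rewrite tf_mulK !compm1 -[RHS]compA assoc_nat compA.
by rewrite -tens1mM.
Qed.

(** Since [F P'] is dual to [F P], maps [W -> P ⊗ X] correspond to maps [P' ⊗ W -> X], then to
    [F P' ⊗ F W -> Y], then to [F W -> F P ⊗ Y]; [transpF] identifies this chain with composition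
    with [tens_semilin P h]. *)
Lemma cartesian_act P X (Y : D) (h : hom (F X) Y) :
  is_rigid C -> cartesian h -> cartesian (tens_semilin P h).
Proof.
move=> rigidC cart_h.
have [[P' [ev [coev dualP]]] _] := rigidC P.
have dualFP := tf_left_dual F dualP.
have transpF W (f : hom (P' ⊗ W) X) :
    tens_semilin P h ∘ fmap F (transp coev f)
    = transp (tf_muli F P P' ∘ fmap F coev ∘ lax_one F)
        (h ∘ fmap F f ∘ lax_mul F P' W).
  (* Associativity of the monoidal structure of [F] with two occurrences of [lax_mul] inverted. *)
  have muliA : tf_muli F P (P' ⊗ W) ∘ fmap F (assoc P P' W)
        ∘ lax_mul F (P ⊗ P') W
      = (idm (F P) ⊗ₘ lax_mul F P' W) ∘ assoc (F P) (F P') (F W)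
        ∘ (tf_muli F P P' ⊗ₘ idm (F W)).
    apply: (iso_epi (tens_iso (tf_mul_iso F P P') (idm_iso (F W)))).
    rewrite (comp_mid3 (lax_mulA _ _ _ _)) tf_mulK comp1m -[RHS]compA -tensm1M.
    by rewrite tf_mulK tensm1 compm1.
  rewrite /tens_semilin /transp !tens1mM !fmapM !compA.
  rewrite (comp_mid (tf_muli_nat _ _ _)).
  rewrite fmap1 -one_luniti !compA -(comp_mid (lax_mul_natl _ _ _)).
  by rewrite (comp_mid3 muliA) !tensm1M !compA.
move=> W g.
have [f [hf f_uniq]] := cart_h _
  (untransp (tf_onei F ∘ fmap F ev ∘ lax_mul F P' P) g ∘ tf_muli F P' W).
exists (transp coev f); split.
  rewrite transpF hf -(compA _ (tf_muli _ _ _)) tf_mulK compm1.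
  by rewrite (untranspK dualFP).
move=> f'; rewrite -(untranspK dualP f') transpF => hf'.
congr transp; apply: f_uniq; rewrite -hf' (transpK dualFP).
by rewrite -(compA _ (lax_mul _ _ _)) tf_muliK compm1.
Qed.

End Semilinear.

(** * Descent of exactness along a cartesian algebra map [F B -> A] *)

Section AlgebraMap.
Variables (k : fieldType) (C D : monCat k) (F : tensorFunctor C D).
Variables (B : algebra C) (A : algebra D) (eps : hom (F B) (A : D)).
Hypothesis eps_mul : @semilin k C D F B A eps (regular_rmod B) (regular_rmod A) eps.
Hypothesis eps_one : eps ∘ fmap F (alg_one B) = alg_one A ∘ tf_onei F.

(** The free [A]-module on [F c] is the base change of the free [B]-module on [c]: [g] is defined on
    generators, and semilinear maps agreeing on generators are equal. *)
Lemma semilin_free_ext c (N : rmod A)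
    (h : hom (F (rmod_act c (regular_rmod B))) (N : D)) :
  semilin eps h ->
  exists g : hom (rmod_act (F c) (regular_rmod A) : D) N,
    rlin g /\ g ∘ tens_semilin c eps = h.
Proof.
move=> semi_h.
have basisA := basis_act (F c) (basis_regular A).
have basisB := basis_act c (basis_regular B).
(* The prescribed values are those of [h] on the generators [c ⊗ 1], with [F c ⊗ 1] identified with
   [F (c ⊗ 1)]. *)
have [g [lin_g gj]] := basis_ext
  (h ∘ fmap F (idm c ⊗ₘ alg_one B) ∘ lax_mul F c (one C)
     ∘ (idm (F c) ⊗ₘ lax_one F)) basisA.
exists g; split=> //.
apply: (semilin_uniq basisB _ semi_h).
  by apply: semilin_rlin lin_g; apply: semilin_act.
rewrite /tens_semilin -!compA tf_muli_nat fmap1 (compA (idm _ ⊗ₘ eps)) -tens1mM.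
rewrite eps_one tens1mM !compA gj (comp_idr (g := idm _ ⊗ₘ lax_one F)).
  by rewrite (comp_idr (tf_muliK _ _ _)).
by rewrite -tens1mM tf_oneiK tensm1.
Qed.

Hypothesis rigidC : is_rigid C.
Hypotheses (abD : is_abelian D) (rigidD : is_rigid D).
Hypothesis cart_eps : cartesian eps.

(** The map [U] of free [A]-modules attached to [u] is regular after tensoring with [F P]; its
    quasi-inverse [R] lifts to [r] along cartesian maps, which also reflect the equation. *)
Lemma exact_algebra_regular_descent P c0 c1
    (u : hom (rmod_act c1 (regular_rmod B) : C) (rmod_act c0 (regular_rmod B))) :
  exact_algebra A -> projective (F P) -> rlin u ->
  exists r : hom (rmod_act P (rmod_act c0 (regular_rmod B)) : C)
                 (rmod_act P (rmod_act c1 (regular_rmod B))),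
    rlin r /\ (idm P ⊗ₘ u) ∘ r ∘ (idm P ⊗ₘ u) = idm P ⊗ₘ u.
Proof.
move=> exA projFP lin_u.
have semi c := semilin_act c eps_mul.
have cart c := cartesian_act (P := c) rigidC cart_eps.
have semiP c := semilin_act P (semi c).
have cartP c := cartesian_act (P := P) rigidC (cart c).
have [U [lin_U Uk]] := semilin_free_ext (rlin_semilin (semi c0) lin_u).
have [R [lin_R URU]] := exact_algebra_regular abD rigidD exA projFP lin_U
  (basis_act (F c0) (basis_regular A)).
have [r [lin_r Rk]] := cartesian_lift (semiP c0) (semiP c1) (cartP c1) lin_R.
exists r; split=> //.
exact: cartesian_regular (cartP c0) (tens_semilin_nat P (esym Uk)) Rk URU.
Qed.

(* The bar resolution [(M ⊗ B) ⊗ B -> M ⊗ B -> M] is split in [C], so that a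
   quasi-inverse of its first map tensored with [P] makes [P ▷ M] a retract of
   the projective module [P ▷ (M ⊗ B)]. *)
Lemma exact_algebra_descent :
  is_abelian C -> (forall P, projective P -> projective (F P)) ->
  exact_algebra A -> exact_algebra B.
Proof.
move=> abC projF exA _ P M projP.
(* The unit of [B] gives a section of every action, natural in [C] but in general not linear. *)
pose sg (X : C) : hom X (X ⊗ B) := (idm X ⊗ₘ alg_one B) ∘ runiti X.
have sg_nat X Y (f : hom X Y) : (f ⊗ₘ idm B) ∘ sg X = sg Y ∘ f.
  by rewrite /sg compA tensm_swap -!compA runiti_nat.
have ract_sg (N : rmod B) : ract N ∘ sg N = idm (N : C).
  by rewrite /sg compA ract1 runitiK.
pose L c := rmod_act c (regular_rmod B).
have lin_act : @rlin _ _ _ (L M) M (ract M) by apply: rlin_ract.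
pose u : hom (L (M ⊗ B) : C) (L M) := (ract M ⊗ₘ idm B) - ract (L M).
have lin_u : rlin u.
  exact: rlinB (rlin_actl (regular_rmod B) (ract M)) (rlin_ract (L M)).
have act_u : ract M ∘ u = 0 by rewrite /u compBr ractM /= compA subrr.
have u_sg : u ∘ sg (M ⊗ B) = sg M ∘ ract M - idm (M ⊗ B).
  by rewrite /u compBl sg_nat (ract_sg (L M)).
have [r [lin_r uru]] := exact_algebra_regular_descent exA (projF _ projP) lin_u.
pose e := idm (P ⊗ (M ⊗ B)) - (idm P ⊗ₘ u) ∘ r.
have lin_e : @rlin _ _ _ (rmod_act P (L M)) (rmod_act P (L M)) e.
  apply: rlinB (rlin_idm (rmod_act P (L M))) _.
  exact: rlin_comp (rlin_act P lin_u) lin_r.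
(* By [u_sg], [sg M ∘ ract M] differs from the identity by [u ∘ sg (M ⊗ B)]. As [e] kills [P ⊗ u],
   composing [t] with [P ⊗ ract M] gives back [e]. *)
pose t := e ∘ (idm P ⊗ₘ sg M).
have t_act : t ∘ (idm P ⊗ₘ ract M) = e.
  have -> : t ∘ (idm P ⊗ₘ ract M)
      = e + e ∘ (idm P ⊗ₘ u) ∘ (idm P ⊗ₘ sg (M ⊗ B)).
    rewrite /t -!compA -!tens1mM u_sg tensBr compBr tensm1 compm1.
    by rewrite addrC subrK.
  by rewrite {2}/e compBl comp1m uru subrr comp0m addr0.
have act_t : (idm P ⊗ₘ ract M) ∘ t = idm (P ⊗ M).
  rewrite /t /e compBl comp1m compBr -tens1mM ract_sg tensm1 !compA -tens1mM.
  by rewrite act_u tensm0 !comp0m subr0.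
(* Although [sg M] may fail to be linear, [t] is: after the epimorphism [(P ⊗ ract M) ⊗ B] the claim
   becomes linearity of [e]. *)
have lin_t : @rlin _ _ _ (rmod_act P M) (rmod_act P (L M)) t.
  have epi_act : epi ((idm P ⊗ₘ ract M) ⊗ₘ idm B).
    apply: tensr_epi => //; apply: tensl_epi => // Z g h gh.
    by rewrite -(compm1 g) -(compm1 h) -ract_sg !compA gh.
  apply: epi_act; transitivity (e ∘ ract (rmod_act P (L M))).
    rewrite -t_act -[LHS]compA -[RHS]compA.
    exact: (congr1 (comp t) (esym (rlin_act P lin_act))).
  by rewrite -compA -tensm1M t_act; apply: lin_e.
apply: (@projective_retract _ _ _ (rmod_act P (L M) : rmod_linCat B)
  (mk_rmodHom lin_t) (mk_rmodHom (rlin_act P lin_act))).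
  exact: rmod_hom_inj.
apply: (basis_projective abC rigidC (basis_act P (basis_act M (basis_regular B)))).
exact: tensr_projective.
Qed.

End AlgebraMap.

Theorem corollary4p5 (k : closedFieldType) (C D : finTensorCat k)
    (F : tensorFunctor C D) (Fra : right_adjoint F) :
  perfect F Fra ->
  forall A : algebra D,
    exact_algebra A -> exact_algebra (lax_algebra (radj_lax Fra) A).
Proof.
move=> perfF A exA; pose B := lax_algebra (radj_lax Fra) A.
(* The counit at [A] serves as [eps]: it is an algebra map because the lax structure on the right
   adjoint is a mate, and cartesian by the adjunction bijection. *)
refine (@exact_algebra_descent k C D F B A (counit_adj Fra A) _ _ _ _ _ _ _ _ exA).
- rewrite /semilin /= fmapM compA -counit_adj_nat -!compA.
  by rewrite (compA (counit_adj _ _)) eps_mulE.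
- by rewrite /= fmapM compA -counit_adj_nat -compA eps_one.
- exact: ftc_rigid.
- exact: ftc_abelian.
- exact: ftc_rigid.
- move=> X g; exists (fmap Fra g ∘ unit_adj Fra X); split.
    exact: eps_transpose.
  by move=> f epsf; apply: radj_inj; rewrite eps_transpose.
- exact: ftc_abelian.
- by move=> P; apply: left_adjoint_projective perfF; apply: ftc_abelian.
Qed.
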